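(* Let $n\ge 3$ be an integer, $0<m<\frac{n-2}{n}$, $\gamma>0$ with $\gamma\ne\frac{2}{1-m}$, and $\eta>0$. Let $\alpha\in\mathbb{R}$ and $\beta\in\mathbb{R}\setminus\{0\}$ satisfy $$\alpha=\frac{2\beta-1}{1-m}.$$ Suppose there exists a radially symmetric solution $f$ of $$\Delta (f^m/m)+\alpha f+\beta x\cdot\nabla f=0,\quad f>0,\quad\text{ in }\mathbb{R}^n\setminus\{0\}$$ which satisfies $$\lim_{|x|\to 0}|x|^{\gamma}f(x)=\eta.$$ Then $$\alpha<0\quad\text{ and }\quad\beta<0.$$
   Context: ''Solution'' means a classical (twice continuously differentiable) positive function satisfying the equation pointwise on $\mathbb{R}^n\setminus\{0\}$. Radially symmetric means that $f(x)$ depends only on $|x|$. *)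

(* Defs.v *)
(* Functions on R^n \ {0} are represented by total functions on R^n whose value
   at 0 is never used. The norm `|x| of the library on 'rV[R]_n is the sup norm,
   which induces the usual topology (used for limits and continuity) but is not
   the Euclidean length, hence enorm. *)
From HB Require Import structures.
From mathcomp Require Import all_boot all_order all_algebra.
From mathcomp Require Import all_classical all_reals all_analysis.

Set Implicit Arguments.
Unset Strict Implicit.
Unset Printing Implicit Defensive.

Import Order.TTheory GRing.Theory Num.Theory.
Import numFieldNormedType.Exports.

Local Open Scope classical_set_scope.
Local Open Scope ring_scope.

Section PuncturedSpace.
Context {R : realType} {n : nat}.
Implicit Types (x y : 'rV[R]_n) (f g : 'rV[R]_n -> R).

Definition dotv x y : R := \sum_(i < n) x 0 i * y 0 i.

Definition enorm x : R := Num.sqrt (\sum_(i < n) x 0 i ^+ 2).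

Definition partial (i : 'I_n) f x : R := 'D_(delta_mx 0 i) f x.

Definition grad f x : 'rV[R]_n := \row_(i < n) partial i f x.

Definition laplacian f x : R := \sum_(i < n) partial i (partial i f) x.

Definition C0_punctured f : Prop :=
  forall x, x != 0 -> {for x, continuous f}.

(* 'D_v f x is a total operator, so the existence of each partial derivative
   has to be required separately. *)
Definition C1_punctured f : Prop :=
  C0_punctured f /\
  forall i : 'I_n,
    (forall x, x != 0 -> derivable f x (delta_mx 0 i)) /\
    C0_punctured (partial i f).

Definition C2_punctured f : Prop :=
  C1_punctured f /\ forall i : 'I_n, C1_punctured (partial i f).

Definition radially_symmetric f : Prop :=
  forall x y, x != 0 -> y != 0 -> enorm x = enorm y -> f x = f y.

Definition is_solution (m alpha beta : R) f : Prop :=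
  [/\ C2_punctured f,
      forall x, x != 0 -> 0 < f x &
      forall x, x != 0 ->
        laplacian (fun y => f y `^ m / m) x
          + alpha * f x + beta * dotv x (grad f x) = 0].

End PuncturedSpace.

(* Main.v *)
Require Import Defs.
From HB Require Import structures.
From mathcomp Require Import all_boot all_order all_algebra.
From mathcomp Require Import all_classical all_reals all_analysis.
From mathcomp Require Import ring lra.

Set Implicit Arguments.
Unset Strict Implicit.
Unset Printing Implicit Defensive.

Import Order.TTheory GRing.Theory Num.Theory.
Import numFieldNormedType.Exports.

Local Open Scope classical_set_scope.
Local Open Scope ring_scope.

(** Near the origin either the diffusion term or the first order term of the
    equation dominates, and the dominant one alone must vanish on the profile
    [eta * |x|^(- gamma)]. Put [u = f^m / m]. The diffusion term has the size of
    [|x|^(- m gamma - 2)] and the first order term that of [|x|^(- gamma)], so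
    the threshold is [gamma = 2 / (1 - m)].
    - If [gamma < 2 / (1 - m)], the power [|x|^(- m gamma)] must be harmonic, so
      [m gamma = n - 2]; since [m < (n - 2) / n] this forces
      [gamma > 2 / (1 - m)], a contradiction.
    - If [gamma > 2 / (1 - m)], the power [|x|^(- gamma)] must be killed by
      [alpha + beta x . grad], so [alpha = beta gamma]. Together with
      [alpha (1 - m) = 2 beta - 1] this gives
      [beta ((1 - m) gamma - 2) = - 1]: hence [beta < 0], and [alpha < 0].

    The difficulty is that only [f] itself, and none of its derivatives, is
    controlled near the origin. With [r = e^t] the radial equation can be written
    as [P' = k (n - 2 - k) V + (beta (k + 2) - alpha) W], where
    [V = r^k u], [W = r^(k + 2) f] and
    [P = r^(k + 1) u_r + (n - 2 - k) V + beta W], for any real [k]. Here [V] and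
    [W] converge for a suitable [k], so [P'] converges, while [V' - P] is a
    combination of [V] and [W] and hence bounded. If the limit of [P'] were not
    zero, [P], hence [V'], would be unbounded with a sign and [V] could not
    converge ([lim_second_derivative_eq0]). So the right-hand side tends to zero
    ([selfsimilar_asymptotics]); [k = m gamma] and [k = gamma - 2] give the two
    cases. What remains is the reduction of the equation, stated with partial
    derivatives, to an ordinary differential equation along a coordinate
    half-line ([laplacian_ray], [radial_equation]). *)

(** * Calculus of one variable near minus infinity *)

Section Calculus.
Context {R : realType}.
Implicit Types (V P : R -> R).

(** Reduces directional derivatives in a normed space to derivatives of
    functions of one real variable, for which the chain rule and the mean value
    theorem are available. *)
Lemma is_derive_along_line (W : normedModType R) (f : W -> R) (x v : W) (h d : R) :
  is_derive (x + h *: v) v f d <->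
  is_derive h 1 (fun s => f (x + s *: v)) d.
Proof.
have E : (fun s => s^-1 *: ((f \o shift (x + h *: v)) (s *: v) - f (x + h *: v)))
  = (fun s => s^-1 *: (((fun s => f (x + s *: v)) \o shift h) (s *: 1)
       - f (x + h *: v))).
  apply/funext => s /=; congr (_ *: (f _ - _)).
  by rewrite [_%:A]mulr1 scalerDl addrCA.
by split=> -[hd hl]; split; rewrite /derivable /derive ?E -?E // -?hl /derive ?E.
Qed.

(** If [P'] stays above [l / 2 > 0] near [-oo], then [P], and with it [V'],
    tends to [-oo] at [-oo]; so [V] grows without bound as [t] decreases. *)
Lemma lim_second_derivative_not_gt0 V P (dV dP : R -> R) (C D l : R) :
  (forall t : R, is_derive t 1 V (dV t)) -> (forall t : R, is_derive t 1 P (dP t)) ->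
  (\forall t \near -oo, `|V t| <= C) ->
  (\forall t \near -oo, `|dV t - P t| <= D) ->
  dP t @[t --> -oo] --> l -> ~ 0 < l.
Proof.
move=> hV hP bV bP hl l0.
have mvt (f df : R -> R) : (forall t : R, is_derive t 1 f (df t)) ->
    forall a b, a < b -> exists2 c, c < b & f b - f a = df c * (b - a).
  move=> hf a b ab; have [|c cab ->] := MVT ab (fun t _ => hf t).
    by apply: derivable_within_continuous => t _; exact: ex_derive.
  by exists c => //; rewrite (itvP cab).
have hlarge : \forall t \near -oo, l / 2 <= dP t.
  apply: (cvgr_ge l) => //; lra.
have : \forall t \near -oo, [/\ `|V t| <= C, `|dV t - P t| <= D & l / 2 <= dP t].
  near=> t; split; near: t => //.
move=> [M [_ hM]].
pose T := M - 1.
(* From P' >= l / 2, this S gives P t <= - |D| - 1 for t <= S, so V' t <= -1. *)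
pose S := T - (2 / l) * (`|P T| + `|D| + 1) - 1.
have ST : S < T by rewrite /S; have : 0 < (2 / l) * (`|P T| + `|D| + 1); [|lra];
  rewrite mulr_gt0 ?divr_gt0// ltr_wpDl ?addr_ge0.
have dVle t : t <= S -> dV t <= - 1.
  move=> tS; have tT : t < T by exact: le_lt_trans ST.
  have [c cT hc] := mvt _ _ hP _ _ tT.
  have [_ _ hlc] : [/\ `|V c| <= C, `|dV c - P c| <= D & l / 2 <= dP c].
    by apply: hM; rewrite /T in cT; lra.
  have [_ + _] : [/\ `|V t| <= C, `|dV t - P t| <= D & l / 2 <= dP t].
    by apply: hM; rewrite /T in tT; lra.
  rewrite ler_norml => /andP[_ h1].
  have h2 : l / 2 * (T - t) <= P T - P t.
    by rewrite hc ler_wpM2r// subr_ge0 ltW.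
  have h3 : `|P T| + `|D| + 1 <= l / 2 * (T - t).
    have -> : `|P T| + `|D| + 1 = l / 2 * ((2 / l) * (`|P T| + `|D| + 1)).
      by field; lra.
    by rewrite ler_wpM2l //; rewrite /S in tS; lra.
  by have := ler_norm (P T); have := ler_norm D; lra.
have C0 : 0 <= C.
  have [+ _ _] : [/\ `|V S| <= C, `|dV S - P S| <= D & l / 2 <= dP S].
    by apply: hM; rewrite /T in ST; lra.
  exact: le_trans.
(* Moving left from S by 2 C + 1 raises V by at least 2 C + 1. *)
have tS : S - (2 * C + 1) < S by lra.
have [c cS hc] := mvt _ _ hV _ _ tS.
have h1 : dV c <= - 1 by apply: dVle; exact: ltW.
have h2 : dV c * (S - (S - (2 * C + 1))) <= - 1 * (S - (S - (2 * C + 1))).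
  by rewrite ler_wpM2r//; lra.
have [+ _ _] : [/\ `|V S| <= C, `|dV S - P S| <= D & l / 2 <= dP S].
  by apply: hM; rewrite /T in ST; lra.
rewrite ler_norml => /andP[h3 h3'].
have [+ _ _] := hM (S - (2 * C + 1)) ltac:(rewrite /T in ST; lra).
rewrite ler_norml => /andP[h4 h4'].
lra.
Unshelve. all: by end_near. Qed.

(** [V' - P] being bounded, [P'] stands for the second derivative of the bounded
    function [V], which need not exist. *)
Lemma lim_second_derivative_eq0 (V P dV dP : R -> R) (C D l : R) :
  (forall t : R, is_derive t 1 V (dV t)) -> (forall t : R, is_derive t 1 P (dP t)) ->
  (\forall t \near -oo, `|V t| <= C) ->
  (\forall t \near -oo, `|dV t - P t| <= D) ->
  dP t @[t --> -oo] --> l -> l = 0.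
Proof.
move=> hV hP bV bP hl; apply/eqP/negPn/negP => /lt_total/orP[l0|]; last first.
  exact: lim_second_derivative_not_gt0 hV hP bV bP hl.
apply: (@lim_second_derivative_not_gt0 (fun t => - V t) (fun t => - P t)
  (fun t => - dV t) (fun t => - dP t) C D (- l)).
- by apply: filterS bV => t; rewrite normrN.
- by apply: filterS bP => t; rewrite -opprD normrN.
- exact: cvgN.
- by rewrite oppr_gt0.
Qed.

Lemma cvg_expR_Ny (d : R) : 0 < d -> expR (d * t) @[t --> -oo] --> (0 : R).
Proof.
move=> d0; apply: (@cvg_comp _ _ _ _ _ _ (@ninfty_nbhs R)).
  by apply: gt0_cvgMrNy.
exact/cvgNy_compNP/cvgr_expR.
Qed.

End Calculus.

(** * Radial functions along a coordinate half-line *)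

Section Ray.
Context {R : realType} {n : nat}.
Implicit Types (x : 'rV[R]_n) (f u : 'rV[R]_n -> R) (i j : 'I_n).

Lemma enorm_ray_add i j (r h : R) : i != j ->
  enorm (r *: 'e_i + h *: 'e_j) = Num.sqrt (r ^+ 2 + h ^+ 2).
Proof.
move=> ij; rewrite /enorm (bigD1 i)//= (bigD1 j) 1?eq_sym//= big1 => [|k /andP[ki kj]].
  by rewrite !mxE !eqxx (negbTE ij) eq_sym (negbTE ij) !mulr1 !mulr0 addr0 add0r addr0.
by rewrite !mxE !eqxx (negbTE ki) (negbTE kj) !mulr0 addr0 expr0n.
Qed.

Lemma enorm_ray i (r : R) : 0 <= r -> enorm (r *: 'e_i) = r.
Proof.
move=> r0; rewrite /enorm (bigD1 i)//= big1 => [|k ki].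
  by rewrite !mxE !eqxx mulr1 addr0 sqrtr_sqr ger0_norm.
by rewrite !mxE !eqxx (negbTE ki) mulr0 expr0n.
Qed.

Lemma ray_neq0 i (r : R) : r != 0 -> r *: 'e_i != 0 :> 'rV[R]_n.
Proof.
by move=> r0; apply/rV0Pn; exists i; rewrite !mxE !eqxx mulr1.
Qed.

Lemma ray_add_neq0 i j (r h : R) : i != j -> r != 0 ->
  r *: 'e_i + h *: 'e_j != 0 :> 'rV[R]_n.
Proof.
move=> ij r0; apply/rV0Pn; exists i.
by rewrite !mxE !eqxx (negbTE ij) mulr1 mulr0 addr0.
Qed.

Lemma is_derive_ray f i (r : R) : derivable f (r *: 'e_i) ('e_i) ->
  is_derive r 1 (fun s => f (s *: 'e_i)) (partial i f (r *: 'e_i)).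
Proof.
move=> /derivableP hf; rewrite -[r *: _]add0r in hf.
move/is_derive_along_line: hf; rewrite add0r => hf.
by under eq_fun do rewrite -[_ *: _]add0r.
Qed.

Lemma is_derive_sqrtD (r h : R) : 0 < r ->
  is_derive h 1 (fun s => Num.sqrt (r ^+ 2 + s ^+ 2))
    (h / Num.sqrt (r ^+ 2 + h ^+ 2)).
Proof.
move=> r0; have p : 0 < r ^+ 2 + h ^+ 2 by rewrite ltr_wpDr ?sqr_ge0// exprn_gt0.
have h1 : is_derive h 1 (fun s => r ^+ 2 + s ^+ 2) (2 * h).
  apply: is_derive_eq; rewrite add0r /GRing.scale/= mulr1 -mulr_natl; ring.
have := is_derive1_comp (g := fun s : R => r ^+ 2 + s ^+ 2) (is_derive1_sqrt p) h1.
move=> H; apply: (@is_derive_eq _ _ _ _ _ _ _ _ H).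
have : Num.sqrt (r ^+ 2 + h ^+ 2) != 0 by rewrite gt_eqF ?sqrtr_gt0.
by move=> ?; field.
Qed.

(** For [j != i], radial symmetry turns [u (r e_i + h e_j)] into the restriction
    of [u] to the half-line of [e_i], evaluated at [sqrt (r ^ 2 + h ^ 2)]. Hence
    [partial j u (r e_i + h e_j)] is [partial i u] at that point times
    [h / sqrt (r ^ 2 + h ^ 2)], whose derivative at [h = 0] is
    [partial i u (r e_i) / r]: the [n - 1] transversal directions contribute
    equally. *)
Lemma laplacian_ray u i (r : R) : 0 < r ->
  radially_symmetric u ->
  (forall x, x != 0 -> derivable u x ('e_i)) ->
  derivable (partial i u) (r *: 'e_i) ('e_i) ->
  laplacian u (r *: 'e_i) =
    partial i (partial i u) (r *: 'e_i)
      + (n%:R - 1) * (partial i u (r *: 'e_i) / r).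
Proof.
move=> r0 radu du ddu; rewrite /laplacian (bigD1 i)//=; congr (_ + _).
have rn0 : r != 0 by rewrite gt_eqF.
pose q h := Num.sqrt (r ^+ 2 + h ^+ 2).
have q_gt0 h : 0 < q h by rewrite sqrtr_gt0 ltr_wpDr ?sqr_ge0// exprn_gt0.
have q0 : q 0 = r by rewrite /q expr0n addr0 sqrtr_sqr gtr0_norm.
have dq (h : R) : is_derive h 1 q (h / q h) by exact: is_derive_sqrtD.
rewrite (eq_bigr (fun=> partial i u (r *: 'e_i) / r)) => [|j ji]; last first.
  have ij : i != j by rewrite eq_sym.
  have hline s : u (r *: 'e_i + s *: 'e_j) = u (q s *: 'e_i).
    apply: radu; [exact: ray_add_neq0 | by rewrite ray_neq0 ?gt_eqF |].
    by rewrite enorm_ray_add// enorm_ray// ltW.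
  have hpart h : partial j u (r *: 'e_i + h *: 'e_j)
      = partial i u (q h *: 'e_i) * (h / q h).
    rewrite /partial; apply: (@derive_val _ _ _ _ _ u).
    apply/is_derive_along_line; under eq_fun do rewrite hline.
    apply: (is_derive1_comp (g := q) (f := fun s => u (s *: 'e_i))).
    by apply: is_derive_ray; apply: du; rewrite ray_neq0 ?gt_eqF.
  have ray0 : r *: 'e_i = r *: 'e_i + 0 *: 'e_j :> 'rV[R]_n.
    by rewrite scale0r addr0.
  rewrite [X in partial j _ X]ray0 {1}/partial; apply: (@derive_val _ _ _ _ _ (partial j u)).
  apply/is_derive_along_line; under eq_fun do rewrite hpart.
  have h1 : is_derive (0 : R) 1 (fun h => partial i u (q h *: 'e_i))
      (partial i (partial i u) (r *: 'e_i) * 0).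
    apply: (is_derive1_comp (g := q) (f := fun s => partial i u (s *: 'e_i))).
      by rewrite q0; exact: is_derive_ray.
    by have := dq 0; rewrite mul0r.
  have qn0 : q 0 != 0 by rewrite gt_eqF.
  have h2 := is_deriveV qn0 (dq 0).
  have h3 : is_derive (0 : R) 1 (fun h => h / q h) (r^-1).
    apply: (is_derive_eq (is_deriveM (is_derive_id (0 : R) 1) h2)).
    by rewrite q0 /GRing.scale/=; field.
  apply: (is_derive_eq (is_deriveM h1 h3)).
  by rewrite q0 /GRing.scale/=; field.
rewrite sumr_const cardC1 card_ord -subn1 -[LHS]mulr_natl natrB//.
by rewrite (leq_ltn_trans _ (ltn_ord i)).
Qed.

Lemma is_derive_powR f x (v : 'rV[R]_n) (a d : R) : 0 < f x ->
  is_derive x v f d ->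
  is_derive x v (fun y => f y `^ a) (a * f x `^ (a - 1) * d).
Proof.
move=> fx hf.
have line0 : x + 0 *: v = x by rewrite scale0r addr0.
rewrite -line0 in hf fx *; move/is_derive_along_line: hf => hf.
apply/is_derive_along_line.
have h := is_derive1_comp (f := (@powR R)^~ a) (g := fun s => f (x + s *: v))
  (is_derive1_powR a fx) hf.
exact: h.
Qed.

Lemma is_derive_powRdiv f x (v : 'rV[R]_n) (m d : R) : m != 0 -> 0 < f x ->
  is_derive x v f d ->
  is_derive x v (fun y => f y `^ m / m) (f x `^ (m - 1) * d).
Proof.
move=> m0 fx hf.
have h := is_deriveM (is_derive_powR m fx hf) (is_derive_cst m^-1 x v).
by apply: (is_derive_eq h); rewrite /GRing.scale/=; field.
Qed.

Lemma near_neq0 x : x != 0 -> \forall y \near x, y != 0.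
Proof. by move=> x0; exact: (@cvgr_neq0 R 'rV[R]_n _ (nbhs x) _ id x cvg_id x0). Qed.

Lemma partial_powRdiv f (m : R) i x : m != 0 -> (forall y, y != 0 -> 0 < f y) ->
  (forall y, y != 0 -> derivable f y 'e_i) -> x != 0 ->
  is_derive x 'e_i (fun y => f y `^ m / m) (f x `^ (m - 1) * partial i f x).
Proof.
move=> m0 f0 df x0; apply: is_derive_powRdiv => //; first exact: f0.
exact: derivableP (df _ x0).
Qed.

(** Away from the origin [partial i (f^m / m)] coincides with the product
    [f^(m - 1) * partial i f]; this equality may fail at [0], so derivability is
    transferred from the product near [x] only. *)
Lemma derivable_partial_powRdiv f (m : R) i x :
  m != 0 -> (forall y, y != 0 -> 0 < f y) ->
  (forall y, y != 0 -> derivable f y 'e_i) ->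
  (forall y, y != 0 -> derivable (partial i f) y 'e_i) -> x != 0 ->
  derivable (partial i (fun y => f y `^ m / m)) x 'e_i.
Proof.
move=> m0 f0 df ddf x0.
pose g y := f y `^ (m - 1) * partial i f y.
apply: (@near_eq_derivable _ _ _ g).
  near=> y; symmetry; apply: derive_val; apply: partial_powRdiv => //.
  by near: y; exact: near_neq0.
apply: derivableM; last exact: ddf.
apply: ex_derive; apply: is_derive_powR; first exact: f0.
exact: derivableP (df _ x0).
Unshelve. all: by end_near. Qed.

End Ray.

(** * The radial equation and its behaviour at the origin *)

Section Asymptotics.
Context {R : realType}.

(** The relation that the limits of [r^k u] and [r^(k + 2) f] at [r = 0] inherit
    from the radial equation in dimension [N]. In the variable [t = log r], the
    equation multiplied by [r^(k + 2)] is the derivative of the flux [P] plus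
    terms of order zero in [u] and [f]; [P'] tends to zero by
    [lim_second_derivative_eq0], and the terms of order zero are then balanced
    in the limit. *)
Lemma selfsimilar_asymptotics (u du ddu f df : R -> R) (N alpha beta k a b : R) :
  (forall r : R, 0 < r -> is_derive r 1 u (du r)) ->
  (forall r : R, 0 < r -> is_derive r 1 du (ddu r)) ->
  (forall r : R, 0 < r -> is_derive r 1 f (df r)) ->
  (forall r, 0 < r ->
    ddu r + (N - 1) * (du r / r) + alpha * f r + beta * (r * df r) = 0) ->
  expR (k * t) * u (expR t) @[t --> -oo] --> a ->
  expR ((k + 2) * t) * f (expR t) @[t --> -oo] --> b ->
  k * (N - 2 - k) * a + (beta * (k + 2) - alpha) * b = 0.
Proof.
move=> hu hdu hf ode ha hb.
have expD s (t : R) : is_derive t 1 (fun t => expR (s * t)) (s * expR (s * t)).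
  have h : is_derive t 1 (fun t : R => s * t) s.
    by apply: is_derive_eq; rewrite /GRing.scale/=; ring.
  have := is_derive1_comp (f := @expR R) (g := fun t => s * t) (is_derive_expR _) h.
  by rewrite mulrC.
have compD (g dg : R -> R) : (forall r : R, 0 < r -> is_derive r 1 g (dg r)) ->
    forall t : R, is_derive t 1 (fun t => g (expR t)) (dg (expR t) * expR t).
  move=> hg t.
  exact (is_derive1_comp (hg _ (expR_gt0 t)) (is_derive_expR t)).
pose V t := expR (k * t) * u (expR t).
pose W t := expR ((k + 2) * t) * f (expR t).
(* The coefficient N - 2 - k is the one that cancels u_r in P'. *)
pose P t := expR (k * t) * (expR t * du (expR t)) + (N - 2 - k) * V t
  + beta * W t.
have dV (t : R) :
    is_derive t 1 V (k * V t + expR (k * t) * (expR t * du (expR t))).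
  have h := is_deriveM (expD k t) (compD _ _ hu t).
  by apply: (is_derive_eq h); rewrite /GRing.scale/= /V; ring.
have dP (t : R) : is_derive t 1 P
    (k * (N - 2 - k) * V t + (beta * (k + 2) - alpha) * W t).
  have h1 := is_deriveM (expD k t) (is_deriveM (is_derive_expR t) (compD _ _ hdu t)).
  have h2 := is_deriveM (expD (k + 2) t) (compD _ _ hf t).
  have h := is_deriveD (is_deriveD h1 (is_deriveZ (N - 2 - k) (dV t)))
    (is_deriveZ beta h2).
  apply: (is_derive_eq h); rewrite /GRing.scale/= /V /W !fctE.
  have r0 : expR t != 0 by rewrite gt_eqF ?expR_gt0.
  have -> : expR ((k + 2) * t) = expR (k * t) * expR t ^+ 2.
    by rewrite expr2 -!expRD; congr expR; ring.
  have {ode} := ode _ (expR_gt0 t); move: (expR t) (expR (k * t)) r0 => r E r0 ode.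
  have -> : ddu r = - ((N - 1) * (du r / r) + alpha * f r + beta * (r * df r)).
    by move/eqP: ode; rewrite -!addrA addr_eq0 => /eqP ->.
  by field.
have bnd := cvgr_norm_le (F := @ninfty_nbhs R).
have := @lim_second_derivative_eq0 R V P _ _ (`|a| + 1)
  (`|(2 * k + 2 - N) * a - beta * b| + 1) _ dV dP.
apply.
- by apply: bnd ha _ _; rewrite ltrDl.
- have hl : (2 * k + 2 - N) * V t - beta * W t @[t --> -oo]
      --> (2 * k + 2 - N) * a - beta * b.
    by apply: cvgB; apply: cvgMl_tmp.
  apply: filterS (bnd _ _ _ _ _ hl _ (_ : _ < `|(2 * k + 2 - N) * a - beta * b| + 1)).
    by move=> t; apply: le_trans; rewrite le_eqVlt; apply/orP; left; apply/eqP;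
      rewrite /P; congr `|_|; ring.
  by rewrite ltrDl.
- by apply: cvgD; apply: cvgMl_tmp.
Qed.

End Asymptotics.

Section RadialSolution.
Context {R : realType} {n : nat}.
Implicit Types (f : 'rV[R]_n -> R) (i : 'I_n).

Lemma dotv_ray i (r : R) (y : 'rV[R]_n) : dotv (r *: 'e_i) y = r * y 0 i.
Proof.
rewrite /dotv (bigD1 i)//= big1 => [|j ji].
  by rewrite !mxE !eqxx mulr1 addr0.
by rewrite !mxE !eqxx (negbTE ji) mulr0 mul0r.
Qed.

(** The half-line of [e_i] carries all the information by radial symmetry; the
    derivative of a function along it is [partial i]. *)
Lemma radial_equation f i (m alpha beta : R) (u := fun y => f y `^ m / m) :
  0 < m -> is_solution m alpha beta f -> radially_symmetric f ->
  forall r : R, 0 < r ->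
  [/\ is_derive r 1 (fun s => f (s *: 'e_i)) (partial i f (r *: 'e_i)),
      is_derive r 1 (fun s => u (s *: 'e_i)) (partial i u (r *: 'e_i)),
      is_derive r 1 (fun s => partial i u (s *: 'e_i))
        (partial i (partial i u) (r *: 'e_i)) &
      partial i (partial i u) (r *: 'e_i)
        + (n%:R - 1) * (partial i u (r *: 'e_i) / r)
        + alpha * f (r *: 'e_i) + beta * (r * partial i f (r *: 'e_i)) = 0].
Proof.
move=> m0 [[[_ df] ddf] f0 eqf] radf r r0.
have mn0 : m != 0 by rewrite gt_eqF.
have dfi y : y != 0 -> derivable f y 'e_i by exact: (df i).1.
have ddfi y : y != 0 -> derivable (partial i f) y 'e_i.
  by move=> y0; have [_ /(_ i)[h _]] := ddf i; exact: h.
have x0 : r *: 'e_i != 0 :> 'rV[R]_n by rewrite ray_neq0 ?gt_eqF.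
have du y : y != 0 -> derivable u y 'e_i.
  by move=> y0; apply: ex_derive; exact: partial_powRdiv.
have ddu : derivable (partial i u) (r *: 'e_i) 'e_i.
  exact: derivable_partial_powRdiv.
split.
- exact/is_derive_ray/dfi.
- exact/is_derive_ray/du.
- exact: is_derive_ray.
have radu : radially_symmetric u.
  by move=> y z y0 z0 yz; rewrite /u (radf y z).
have := eqf _ x0; rewrite (laplacian_ray r0 radu du ddu) dotv_ray.
by rewrite !mxE.
Qed.

Lemma solution_asymptotics f i (m alpha beta k a b : R)
    (u := fun y => f y `^ m / m) :
  0 < m -> is_solution m alpha beta f -> radially_symmetric f ->
  expR (k * t) * u (expR t *: 'e_i) @[t --> -oo] --> a ->
  expR ((k + 2) * t) * f (expR t *: 'e_i) @[t --> -oo] --> b ->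
  k * (n%:R - 2 - k) * a + (beta * (k + 2) - alpha) * b = 0.
Proof.
move=> m0 solf radf ha hb.
have eqs := radial_equation i m0 solf radf.
apply: (@selfsimilar_asymptotics _ (fun r => u (r *: 'e_i))
  (fun r => partial i u (r *: 'e_i))
  (fun r => partial i (partial i u) (r *: 'e_i)) (fun r => f (r *: 'e_i))
  (fun r => partial i f (r *: 'e_i)) n%:R alpha beta k a b _ _ _ _ ha hb).
- by move=> r /eqs[].
- by move=> r /eqs[].
- by move=> r /eqs[].
- by move=> r /eqs[].
Qed.

Lemma cvg_ray0 i : expR t *: 'e_i @[t --> -oo] --> (0 : 'rV[R]_n)^'.
Proof.
have h : expR t *: 'e_i @[t --> -oo] --> (0 : 'rV[R]_n).
  rewrite -[X in _ --> X](scale0r 'e_i); apply: cvgZr_tmp.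
  by have := @cvg_expR_Ny R 1 ltr01; under eq_fun do rewrite mul1r.
move=> A /h hA; suff : \forall t \near -oo, A (expR t *: 'e_i) by [].
apply: (@filterS _ (@ninfty_nbhs R) _ _ _ _ hA) => t; apply.
exact: ray_neq0 (lt0r_neq0 (expR_gt0 t)).
Qed.

Lemma cvg_radial_profile f i (gamma eta : R) :
  enorm x `^ gamma * f x @[x --> (0 : 'rV[R]_n)^'] --> eta ->
  expR (gamma * t) * f (expR t *: 'e_i) @[t --> -oo] --> eta.
Proof.
move=> hf; have := cvg_comp _ _ (@cvg_ray0 i) hf; apply: cvg_trans.
apply: near_eq_cvg; apply: nearW => t /=.
by rewrite enorm_ray ?expR_ge0// -expRM [gamma * t]mulrC.
Qed.

End RadialSolution.

Theorem corollary1p6 (R : realType) (n : nat) (m gamma eta alpha beta : R)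
  (hn : (3 <= n)%N)
  (hm0 : 0 < m) (hm1 : m < (n%:R - 2) / n%:R)
  (hgamma : 0 < gamma) (hgamma_ne : gamma != 2 / (1 - m))
  (heta : 0 < eta)
  (hbeta : beta != 0)
  (halpha : alpha = (2 * beta - 1) / (1 - m))
  (hf : exists f : 'rV[R]_n -> R,
    [/\ is_solution m alpha beta f,
        radially_symmetric f &
        (fun x => enorm x `^ gamma * f x) @ (0 : 'rV[R]_n)^' --> eta]) :
  alpha < 0 /\ beta < 0.
Proof.
have [f [solf radf /cvg_radial_profile limf]] := hf.
have n_gt0 : 0 < n%:R :> R by rewrite ltr0n; exact: leq_trans hn.
have i : 'I_n by apply: (@Ordinal _ 0); exact: leq_trans hn.
have mn : m * n%:R < n%:R - 2 by rewrite -ltr_pdivlMr.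
have m1 : m < 1 by rewrite -(ltr_pM2r n_gt0); lra.
have f0 t : 0 < f (expR t *: 'e_i).
  by have [_ + _] := solf; apply; rewrite ray_neq0 ?gt_eqF ?expR_gt0.
pose u y := f y `^ m / m.
have limu : expR (m * gamma * t) * u (expR t *: 'e_i) @[t --> -oo]
    --> eta `^ m / m.
  have h : (expR (gamma * t) * f (expR t *: 'e_i)) `^ m / m @[t --> -oo]
      --> eta `^ m / m.
    have hc : {for eta, continuous (fun y : R => y `^ m)}.
      apply/differentiable_continuous/derivable1_diffP.
      exact/ex_derive/is_derive1_powR.
    apply: cvgMr_tmp; exact: cvg_comp _ _ (limf i) hc.
  apply: cvg_trans h; apply: near_eq_cvg; apply: nearW => t /=.
  rewrite powRM ?expR_ge0 ?ltW// -expRM /u mulrA; congr (expR _ * _ / _).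
  by ring.
have key := solution_asymptotics hm0 solf radf.
have vanish (c d l : R) (g : R -> R) : d < c ->
    expR (d * t) * g t @[t --> -oo] --> l -> expR (c * t) * g t @[t --> -oo] --> 0.
  rewrite -subr_gt0 => /cvg_expR_Ny h0 /(cvgM h0); rewrite mul0r.
  apply: cvg_trans; apply: near_eq_cvg; apply: nearW => t /=.
  by rewrite mulrA -expRD; congr (expR _ * _); ring.
have m1' : 0 < 1 - m by lra.
(* In each case the exponent k is chosen so that one of the limits a, b of the
   lemma is positive and the other is zero. *)
move: hgamma_ne; rewrite neq_lt => /orP[].
  rewrite ltr_pdivlMr// => glt.
  have lim0 := vanish (m * gamma + 2) gamma _ _ ltac:(lra) (limf i).
  have := key _ _ _ _ limu lim0.
  rewrite mulr0 addr0 => /eqP; rewrite !mulf_eq0 invr_eq0 !(gt_eqF hm0) (gt_eqF hgamma).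
  rewrite (gt_eqF (powR_gt0 _ heta)) /= !orbF => /eqP ngm.
  (* m gamma = n - 2 > m n gives gamma > n, but gamma (1 - m) < 2 < n (1 - m). *)
  have : n%:R - 2 = m * gamma by lra.
  nra.
rewrite ltr_pdivrMr// => glt.
have lim0 := vanish (gamma - 2) (m * gamma) _ _ ltac:(lra) limu.
have lim1 : expR ((gamma - 2 + 2) * t) * f (expR t *: 'e_i) @[t --> -oo] --> eta.
  by rewrite subrK; exact: limf.
have := key _ _ _ _ lim0 lim1.
rewrite mulr0 add0r subrK => /eqP; rewrite mulf_eq0 (gt_eqF heta) orbF subr_eq0.
move=> /eqP bg.
have h : beta * (gamma * (1 - m) - 2) = -1.
  have : alpha * (1 - m) = 2 * beta - 1 by rewrite halpha divfK ?gt_eqF.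
  by rewrite -bg; lra.
have b0 : beta < 0.
  rewrite ltNge; apply/negP => b0.
  have : 0 <= beta * (gamma * (1 - m) - 2) by rewrite mulr_ge0//; lra.
  lra.
by split=> //; rewrite -bg nmulr_rlt0.
Qed.
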